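(* The class $\mathsf{CDLBWE}$ is not definable by pure formulas of the language $\mathcal H_\beta(@,\mathsf E)$; that is, there is no set $\Phi$ of pure formulas such that for every 3-frame $\mathfrak F$, $\mathfrak F\in\mathsf{CDLBWE}$ iff every formula of $\Phi$ is valid on $\mathfrak F$.
   Context: A 3-frame is $\langle W,B\rangle$, $B\subseteq W^3$; $\#(x,y,z)$ means pairwise distinct. $\mathsf{CDLBWE}$: 3-frames satisfying (B1) $B(x,y,z)\to\#(x,y,z)$; (B2) $B(x,y,z)\to B(z,y,x)$; (B3) $B(x,y,z)\to\neg B(x,z,y)$; (B4) $B(x,y,z)\wedge B(y,z,u)\to B(x,y,u)$; (B5) $B(x,y,z)\wedge B(y,u,z)\to B(x,y,u)$; (B6) $\#(x,y,z)\to B(x,y,z)\vee B(x,z,y)\vee B(y,x,z)$; (B7) $\forall y\exists x\exists z\,B(x,y,z)$; (B8) $x\neq z\to\exists y\,B(x,y,z)$; (B9) for all $X,Y\subseteq W$, if there is $w$ with $B(w,x,y)$ for all $x\in X,y\in Y$, then there is $u$ with $B(x,u,y)$ for all $x\in X,y\in Y$. $\mathcal H_\beta(@,\mathsf E)$: $\varphi::=\top\mid p\mid i\mid\neg\varphi\mid\varphi\wedge\psi\mid\langle B\rangle(\varphi,\psi)\mid @_i\varphi\mid\mathsf E\varphi$, interpreted with valuations sending variables to subsets and nominals to singletons; $w\Vdash\langle B\rangle(\varphi,\psi)$ iff there are $x,y$ with $x\Vdash\varphi$, $y\Vdash\psi$, $B(x,w,y)$; $w\Vdash @_i\varphi$ iff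 the element of $V(i)$ satisfies $\varphi$; $w\Vdash\mathsf E\varphi$ iff some point satisfies $\varphi$. A formula is pure if it contains no propositional variables.
   Formalization: In (B9) the conclusion is weakened to ''B(x,u,y) or u=x or u=y'', since with the strict conclusion B(x,u,y) axioms (B1), (B5), (B7), (B9) exclude every nonempty frame and the class would be defined by the pure formula ''not top''. *)

(* Defs.v *)
(* Plain Stdlib world: subsets of a type [W] are predicates [W -> Prop]. *)

Record frame3 : Type := Frame3 {
  point :> Type;
  betw : point -> point -> point -> Prop
}.

Definition distinct3 {W : Type} (x y z : W) : Prop :=
  x <> y /\ y <> z /\ x <> z.

(* Strict betweenness, or [u] is one of the two endpoints. *)
Definition weak_betw (F : frame3) (x u y : F) : Prop :=
  betw F x u y \/ u = x \/ u = y.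

Record CDLBWE (F : frame3) : Prop := {
  betw_distinct : forall x y z : F, betw F x y z -> distinct3 x y z;
  betw_sym : forall x y z : F, betw F x y z -> betw F z y x;
  betw_antisym : forall x y z : F, betw F x y z -> ~ betw F x z y;
  betw_outer_trans : forall x y z u : F,
    betw F x y z -> betw F y z u -> betw F x y u;
  betw_inner_trans : forall x y z u : F,
    betw F x y z -> betw F y u z -> betw F x y u;
  betw_linear : forall x y z : F,
    distinct3 x y z -> betw F x y z \/ betw F x z y \/ betw F y x z;
  betw_unbounded : forall y : F, exists x z : F, betw F x y z;
  betw_dense : forall x z : F, x <> z -> exists y : F, betw F x y z;
  (* Tarski's continuity axiom.  The conclusion is the weak betweenness of
     Tarski's original: the cut point [u] may belong to [X] or to [Y].  With
     [betw F x u y] instead, the other axioms would exclude every nonempty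
     frame: on a line take [X] = (0, 1], [Y] = (1, 2) and [w] = 0. *)
  betw_complete : forall X Y : F -> Prop,
    (exists w : F, forall x y : F, X x -> Y y -> betw F w x y) ->
    exists u : F, forall x y : F, X x -> Y y -> weak_betw F x u y
}.

Inductive formula : Type :=
  | FTop : formula
  | FVar : nat -> formula
  | FNom : nat -> formula
  | FNot : formula -> formula
  | FAnd : formula -> formula -> formula
  | FBetw : formula -> formula -> formula
  | FAt : nat -> formula -> formula
  | FE : formula -> formula.

Fixpoint pure (phi : formula) : Prop :=
  match phi with
  | FTop | FNom _ => True
  | FVar _ => False
  | FNot psi | FAt _ psi | FE psi => pure psi
  | FAnd psi chi | FBetw psi chi => pure psi /\ pure chi
  end.

Record valuation (W : Type) : Type := {
  val_var : nat -> W -> Prop;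
  val_nom : nat -> W -> Prop;
  val_nom_singleton : forall i : nat, exists! w : W, val_nom i w
}.

Arguments val_var {W} _ _ _.
Arguments val_nom {W} _ _ _.

Fixpoint sat (F : frame3) (V : valuation F) (w : F) (phi : formula) : Prop :=
  match phi with
  | FTop => True
  | FVar p => val_var V p w
  | FNom i => val_nom V i w
  | FNot psi => ~ sat F V w psi
  | FAnd psi chi => sat F V w psi /\ sat F V w chi
  | FBetw psi chi =>
      exists x y : F, sat F V x psi /\ sat F V y chi /\ betw F x w y
  | FAt i psi => exists v : F, val_nom V i v /\ sat F V v psi
  | FE psi => exists v : F, sat F V v psi
  end.

Definition valid (F : frame3) (phi : formula) : Prop :=
  forall (V : valuation F) (w : F), sat F V w phi.

(* Main.v *)
Require Import Defs.
From Stdlib Require Import Reals Lra List Arith Classical.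

(** Pure formulas mention only finitely many points, so over betweenness frames
    of nonempty dense linear orders without endpoints they are invariant under
    finite partial isomorphisms, and those extend by one point in either
    direction (back and forth).  Hence the betweenness frames of the real line
    and of two copies of it placed side by side validate the same pure
    formulas; but the first is continuous, while the second has a gap. *)

(** * Dense linear orders without endpoints and interpolation in them *)

Record dense_unbounded_order {T : Type} (lt : T -> T -> Prop) : Prop := {
  lt_irrefl : forall x, ~ lt x x;
  lt_trans : forall x y z, lt x y -> lt y z -> lt x z;
  lt_total : forall x y, lt x y \/ x = y \/ lt y x;
  lt_dense : forall x z, lt x z -> exists y, lt x y /\ lt y z;
  lt_no_min : forall x, exists y, lt y x;
  lt_no_max : forall x, exists y, lt x y
}.

(** Betweenness is a quantifier-free combination of [lt], so whatever preserves and reflects [lt]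
    preserves and reflects it too. *)
Definition order_frame {T : Type} (lt : T -> T -> Prop) : frame3 :=
  Frame3 T (fun x y z => lt x y /\ lt y z \/ lt z y /\ lt y x).

Lemma dense_unbounded_order_flip {T : Type} (lt : T -> T -> Prop) :
  dense_unbounded_order lt -> dense_unbounded_order (fun x y => lt y x).
Proof.
  intros [I Tr To D Mi Ma]; split; eauto.
  - intros x y; destruct (To x y) as [H | [H | H]]; auto.
  - intros x z H; destruct (D _ _ H) as [y [H1 H2]]; eauto.
Qed.

Lemma list_max {T : Type} (lt : T -> T -> Prop) (P : T -> Prop) (l : list T) :
  dense_unbounded_order lt ->
  (forall x, In x l -> ~ P x) \/
  (exists m, In m l /\ P m /\ forall x, In x l -> P x -> x = m \/ lt x m).
Proof.
  intros H; induction l as [| a l IH]; [left; intros x [] |].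
  destruct (classic (P a)) as [Pa | Pa].
  - right; destruct IH as [IH | [m [ml [Pm mmax]]]].
    + exists a; split; [now left | split; [exact Pa |]].
      intros x [-> | xl] Px; [now left | now destruct (IH x xl)].
    + destruct (lt_total lt H a m) as [am | [-> | ma]].
      * exists m; split; [now right | split; [exact Pm |]].
        intros x [<- | xl] Px; auto.
      * exists m; split; [now right | split; [exact Pm |]].
        intros x [<- | xl] Px; auto.
      * exists a; split; [now left | split; [exact Pa |]].
        intros x [<- | xl] Px; auto.
        destruct (mmax x xl Px) as [-> | xm]; [now right |].
        right; exact (lt_trans lt H _ _ _ xm ma).
  - destruct IH as [IH | [m [ml [Pm mmax]]]].
    + left; intros x [<- | xl]; auto.
    + right; exists m; split; [now right | split; [exact Pm |]].
      intros x [<- | xl] Px; [contradiction | auto].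
Qed.

(** Only the greatest listed point of [L] and the least one of [U] matter. Density separates them if
    both exist, the absence of endpoints serves if just one does, and [t] is the answer if neither
    does. *)
Lemma finite_interpolation {T : Type} (lt : T -> T -> Prop) (t : T)
    (L U : T -> Prop) (l : list T) :
  dense_unbounded_order lt ->
  (forall x y, In x l -> In y l -> L x -> U y -> lt x y) ->
  exists b, forall x, In x l -> (L x -> lt x b) /\ (U x -> lt b x).
Proof.
  intros H LU.
  assert (Tr := lt_trans lt H).
  destruct (list_max lt L l H) as [nL | [m [ml [Lm mmax]]]];
    (* A maximum for the flipped order is a minimum for [lt]. *)
    destruct (list_max _ U l (dense_unbounded_order_flip lt H))
      as [nU | [n [nl [Un nmin]]]].
  - exists t; intros x xl; split; intros; exfalso; [apply (nL x) | apply (nU x)];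
      assumption.
  - destruct (lt_no_min lt H n) as [b bn]; exists b; intros x xl; split; intros Px.
    + destruct (nL x xl Px).
    + destruct (nmin x xl Px) as [-> | nx]; eauto.
  - destruct (lt_no_max lt H m) as [b mb]; exists b; intros x xl; split; intros Px.
    + destruct (mmax x xl Px) as [-> | xm]; eauto.
    + destruct (nU x xl Px).
  - destruct (lt_dense lt H m n (LU m n ml nl Lm Un)) as [b [mb bn]].
    exists b; intros x xl; split; intros Px.
    + destruct (mmax x xl Px) as [-> | xm]; eauto.
    + destruct (nmin x xl Px) as [-> | nx]; eauto.
Qed.

(** * Finite partial isomorphisms and back and forth *)

Definition partial_iso {A B : Type} (ltA : A -> A -> Prop) (ltB : B -> B -> Prop)
    (pts : list (A * B)) : Prop :=
  forall a b a' b', In (a, b) pts -> In (a', b') pts -> (ltA a a' <-> ltB b b').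

Definition swap_pair {A B : Type} (p : A * B) : B * A := (snd p, fst p).

Lemma in_map_swap_pair {A B : Type} (pts : list (A * B)) (a : A) (b : B) :
  In (b, a) (map swap_pair pts) <-> In (a, b) pts.
Proof.
  rewrite in_map_iff; split.
  - intros [[a' b'] [E H]]; injection E as <- <-; exact H.
  - intros H; exists (a, b); auto.
Qed.

Lemma partial_iso_swap {A B : Type} (ltA : A -> A -> Prop) (ltB : B -> B -> Prop)
    (pts : list (A * B)) :
  partial_iso ltA ltB pts -> partial_iso ltB ltA (map swap_pair pts).
Proof.
  intros H b a b' a' H1 H2; symmetry.
  apply H; now apply in_map_swap_pair.
Qed.

(** This makes the list of pairs an injective partial function: by totality distinct points are
    strictly comparable, and the comparison carried to the other side would contradict
    irreflexivity. *)
Lemma partial_iso_eq {A B : Type} (ltA : A -> A -> Prop) (ltB : B -> B -> Prop)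
    (pts : list (A * B)) (a a' : A) (b b' : B) :
  dense_unbounded_order ltA -> dense_unbounded_order ltB ->
  partial_iso ltA ltB pts -> In (a, b) pts -> In (a', b') pts ->
  (a = a' <-> b = b').
Proof.
  intros HA HB H P P'.
  assert (E := H _ _ _ _ P P'); assert (E' := H _ _ _ _ P' P).
  assert (IA := lt_irrefl ltA HA); assert (IB := lt_irrefl ltB HB).
  split; intros <-.
  - destruct (lt_total ltB HB b b') as [L | [L | L]]; auto; exfalso.
    + apply (IA a), E, L.
    + apply (IA a), E', L.
  - destruct (lt_total ltA HA a a') as [L | [L | L]]; auto; exfalso.
    + apply (IB b), E, L.
    + apply (IB b), E', L.
Qed.

(** The forth step: the cut that [a] makes among the listed first components is carried over to the
    second ones and filled by interpolation. *)
Lemma partial_iso_extend_left {A B : Type}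
    (ltA : A -> A -> Prop) (ltB : B -> B -> Prop) (pts : list (A * B)) (t : B) (a : A) :
  dense_unbounded_order ltA -> dense_unbounded_order ltB ->
  partial_iso ltA ltB pts -> exists b, partial_iso ltA ltB ((a, b) :: pts).
Proof.
  intros HA HB H.
  assert (IA := lt_irrefl ltA HA); assert (TA := lt_trans ltA HA).
  assert (IB := lt_irrefl ltB HB); assert (TB := lt_trans ltB HB).
  (* A point already paired keeps its partner. A new point differs from every listed one, so each of
     those lies strictly on one side of it. *)
  destruct (classic (exists b, In (a, b) pts)) as [[b Hb] | new].
  { exists b; intros c d c' d' [[= <- <-] | P] [[= <- <-] | P']; apply H; assumption. }
  destruct (finite_interpolation ltB t
    (fun d => exists c, In (c, d) pts /\ ltA c a)
    (fun d => exists c, In (c, d) pts /\ ltA a c) (map snd pts) HB) as [b Hb].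
  { intros d d' _ _ [c [P L]] [c' [P' L']].
    apply (H _ _ _ _ P P'); eauto. }
  assert (Hlo : forall c d, In (c, d) pts -> ltA c a -> ltB d b).
  { intros c d P L; apply (Hb d); [apply (in_map snd _ _ P) | eauto]. }
  assert (Hhi : forall c d, In (c, d) pts -> ltA a c -> ltB b d).
  { intros c d P L; apply (Hb d); [apply (in_map snd _ _ P) | eauto]. }
  assert (Hne : forall c d, In (c, d) pts -> ltA c a \/ ltA a c).
  { intros c d P; destruct (lt_total ltA HA c a) as [L | [-> | L]]; auto.
    destruct new; eauto. }
  exists b; intros c d c' d' [[= <- <-] | P] [[= <- <-] | P'].
  - split; intros L; [destruct (IA _ L) | destruct (IB _ L)].
  (* If [c'] were below [a], then [d'] would be both below and above [b]. *)
  - split; [now apply Hhi |]; intros L.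
    destruct (Hne _ _ P') as [L' | L']; [| exact L'].
    destruct (IB b); eauto.
  - split; [now apply Hlo |]; intros L.
    destruct (Hne _ _ P) as [L' | L']; [exact L' |].
    destruct (IB b); eauto.
  - now apply H.
Qed.

Lemma partial_iso_extend_right {A B : Type}
    (ltA : A -> A -> Prop) (ltB : B -> B -> Prop) (pts : list (A * B)) (t : A) (b : B) :
  dense_unbounded_order ltA -> dense_unbounded_order ltB ->
  partial_iso ltA ltB pts -> exists a, partial_iso ltA ltB ((a, b) :: pts).
Proof.
  intros HA HB H.
  destruct (partial_iso_extend_left ltB ltA _ t b HB HA (partial_iso_swap _ _ _ H))
    as [a Ha].
  exists a; intros c d c' d' P P'; symmetry.
  (* The swap of the extended list computes to the list in [Ha]. *)
  apply Ha; now apply (in_map_swap_pair ((a, b) :: pts)).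
Qed.

(** * Invariance of pure formulas under finite partial isomorphisms *)

Fixpoint nominals (phi : formula) : list nat :=
  match phi with
  | FTop | FVar _ => nil
  | FNom i => i :: nil
  | FNot psi | FE psi => nominals psi
  | FAt i psi => i :: nominals psi
  | FAnd psi chi | FBetw psi chi => nominals psi ++ nominals chi
  end.

(** The restriction to a list [l] is what lets [pts] be finite, since a valuation interprets
    infinitely many nominals. *)
Definition nominals_linked {F G : frame3} (V : valuation F) (V' : valuation G)
    (l : list nat) (pts : list (F * G)) : Prop :=
  forall i, In i l ->
    exists a b, val_nom V i a /\ val_nom V' i b /\ In (a, b) pts.

Lemma nominals_linked_incl {F G : frame3} (V : valuation F) (V' : valuation G)
    (l l' : list nat) (pts pts' : list (F * G)) :
  incl l' l -> incl pts pts' ->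
  nominals_linked V V' l pts -> nominals_linked V V' l' pts'.
Proof.
  intros Hl Hp H i Hi; destruct (H i (Hl i Hi)) as (a & b & Va & Vb & P).
  exists a, b; auto.
Qed.

Lemma val_nom_inj {W : Type} (V : valuation W) (i : nat) (x y : W) :
  val_nom V i x -> val_nom V i y -> x = y.
Proof.
  intros Hx Hy; destruct (val_nom_singleton W V i) as [z [_ Hz]].
  now rewrite <- (Hz x Hx), <- (Hz y Hy).
Qed.

(** Induction on the formula with [pts] general, because each existential witness enlarges the list.
    Purity removes the variables, whose extensions need not match across the pairs. *)
Lemma pure_sat_partial_iso {A B : Type} (ltA : A -> A -> Prop) (ltB : B -> B -> Prop)
    (V : valuation (order_frame ltA)) (V' : valuation (order_frame ltB))
    (phi : formula) :
  dense_unbounded_order ltA -> dense_unbounded_order ltB -> pure phi ->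
  forall (pts : list (A * B)) (a : A) (b : B),
    partial_iso ltA ltB pts -> In (a, b) pts ->
    nominals_linked V V' (nominals phi) pts ->
    (sat (order_frame ltA) V a phi <-> sat (order_frame ltB) V' b phi).
Proof.
  intros HA HB.
  induction phi as [| p | i | psi IH | psi IH chi IH' | psi IH chi IH' | i psi IH | psi IH];
    simpl; intros Hpure pts a b Hiso Hab Hnom.
  - tauto.
  - contradiction.
  (* As [i] names one point on each side, the claim amounts to [a = c <-> b = d]. *)
  - destruct (Hnom i (or_introl eq_refl)) as (c & d & Vc & Vd & P).
    assert (E := partial_iso_eq ltA ltB pts a c b d HA HB Hiso Hab P).
    split; intros Hs.
    + rewrite (proj1 E); auto; exact (val_nom_inj V i _ _ Hs Vc).
    + rewrite (proj2 E); auto; exact (val_nom_inj V' i _ _ Hs Vd).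
  - rewrite (IH Hpure pts a b); tauto.
  - assert (Hnom1 : nominals_linked V V' (nominals psi) pts).
    { exact (nominals_linked_incl V V' _ _ _ _ (incl_appl _ (incl_refl _))
               (incl_refl _) Hnom). }
    assert (Hnom2 : nominals_linked V V' (nominals chi) pts).
    { exact (nominals_linked_incl V V' _ _ _ _ (incl_appr _ (incl_refl _))
               (incl_refl _) Hnom). }
    rewrite (IH (proj1 Hpure) pts a b), (IH' (proj2 Hpure) pts a b); tauto.
  (* Once both witnesses are paired, betweenness reduces to four comparisons between listed pairs;
     back and forth then supplies the partners. *)
  - assert (step : forall x x' y y',
      partial_iso ltA ltB ((y, y') :: (x, x') :: pts) ->
      (sat (order_frame ltA) V x psi <-> sat (order_frame ltB) V' x' psi) /\
      (sat (order_frame ltA) V y chi <-> sat (order_frame ltB) V' y' chi) /\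
      (betw (order_frame ltA) x a y <-> betw (order_frame ltB) x' b y')).
    { intros x x' y y' Hext.
      assert (Px : In (x, x') ((y, y') :: (x, x') :: pts)) by (simpl; auto).
      assert (Py : In (y, y') ((y, y') :: (x, x') :: pts)) by (simpl; auto).
      assert (Pa : In (a, b) ((y, y') :: (x, x') :: pts)) by (simpl; auto).
      assert (Hincl : incl pts ((y, y') :: (x, x') :: pts)) by (intros p; simpl; auto).
      split; [| split].
      - apply (IH (proj1 Hpure) _ x x' Hext Px).
        exact (nominals_linked_incl V V' _ _ _ _ (incl_appl _ (incl_refl _)) Hincl Hnom).
      - apply (IH' (proj2 Hpure) _ y y' Hext Py).
        exact (nominals_linked_incl V V' _ _ _ _ (incl_appr _ (incl_refl _)) Hincl Hnom).
      - simpl.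
        rewrite (Hext _ _ _ _ Px Pa), (Hext _ _ _ _ Pa Py),
          (Hext _ _ _ _ Py Pa), (Hext _ _ _ _ Pa Px); tauto. }
    split.
    + intros (x & y & Hx & Hy & Hxy).
      destruct (partial_iso_extend_left ltA ltB pts b x HA HB Hiso) as [x' Hx'].
      destruct (partial_iso_extend_left ltA ltB _ b y HA HB Hx') as [y' Hy'].
      destruct (step _ _ _ _ Hy') as (E1 & E2 & E3).
      exists x', y'; split; [| split]; [now apply E1 | now apply E2 | now apply E3].
    + intros (x' & y' & Hx & Hy & Hxy).
      destruct (partial_iso_extend_right ltA ltB pts a x' HA HB Hiso) as [x Hx'].
      destruct (partial_iso_extend_right ltA ltB _ a y' HA HB Hx') as [y Hy'].
      destruct (step _ _ _ _ Hy') as (E1 & E2 & E3).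
      exists x, y; split; [| split]; [now apply E1 | now apply E2 | now apply E3].
  (* The point named by [i] is already listed, so evaluation moves there without enlarging [pts]. *)
  - destruct (Hnom i (or_introl eq_refl)) as (c & d & Vc & Vd & P).
    assert (E := IH Hpure pts c d Hiso P
      (nominals_linked_incl V V' _ _ _ _ (incl_tl i (incl_refl _)) (incl_refl _) Hnom)).
    split; intros [v [Vv Hv]].
    + exists d; split; [exact Vd |]; apply E.
      now rewrite (val_nom_inj V i c v Vc Vv).
    + exists c; split; [exact Vc |]; apply E.
      now rewrite (val_nom_inj V' i d v Vd Vv).
  - assert (step : forall x x', partial_iso ltA ltB ((x, x') :: pts) ->
      (sat (order_frame ltA) V x psi <-> sat (order_frame ltB) V' x' psi)).
    { intros x x' Hext; apply (IH Hpure _ x x' Hext (or_introl eq_refl)).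
      exact (nominals_linked_incl V V' _ _ _ _ (incl_refl _)
               (incl_tl _ (incl_refl _)) Hnom). }
    split.
    + intros [x Hx].
      destruct (partial_iso_extend_left ltA ltB pts b x HA HB Hiso) as [x' Hx'].
      exists x'; now apply (step x x').
    + intros [x' Hx].
      destruct (partial_iso_extend_right ltA ltB pts a x' HA HB Hiso) as [x Hx'].
      exists x; now apply (step x x').
Qed.

(** * Transfer of validity between orders *)

Definition nominal_valuation {W : Type} (g : nat -> W) : valuation W :=
  {| val_var := fun _ _ => True;
     val_nom := fun i w => w = g i;
     val_nom_singleton := fun i =>
       ex_intro _ (g i) (conj eq_refl (fun x H => eq_sym H)) |}.

(** The points named in [l] are copied into [B] one at a time by the forth step; nominals outside
    [l] receive the default [t]. *)
Lemma nominals_linked_exists {A B : Type} (ltA : A -> A -> Prop) (ltB : B -> B -> Prop)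
    (t : B) (V : valuation (order_frame ltA)) (l : list nat) :
  dense_unbounded_order ltA -> dense_unbounded_order ltB ->
  exists (pts : list (A * B)) (V' : valuation (order_frame ltB)),
    partial_iso ltA ltB pts /\ nominals_linked V V' l pts.
Proof.
  intros HA HB.
  enough (exists (pts : list (A * B)) (g : nat -> B), partial_iso ltA ltB pts /\
    forall i, In i l -> exists a, val_nom V i a /\ In (a, g i) pts)
    as (pts & g & Hiso & Hg).
  { exists pts, (@nominal_valuation (order_frame ltB) g); split; [exact Hiso |].
    intros i Hi; destruct (Hg i Hi) as [a [Va P]].
    exists a, (g i); simpl; auto. }
  induction l as [| i l (pts & g & Hiso & Hg)].
  - exists nil, (fun _ => t); split; [intros a b a' b' [] | intros i []].
  - destruct (val_nom_singleton _ V i) as [a [Va _]].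
    destruct (partial_iso_extend_left ltA ltB pts t a HA HB Hiso) as [b Hb].
    (* If [i] also occurs in the tail, overwriting [g i] is harmless, since the new pair links it
       again. *)
    exists ((a, b) :: pts), (fun j => if Nat.eq_dec j i then b else g j).
    split; [exact Hb |].
    intros j Hj; destruct (Nat.eq_dec j i) as [-> | ne].
    + exists a; simpl; auto.
    + destruct Hj as [-> | Hj]; [contradiction |].
      destruct (Hg j Hj) as [c [Vc P]]; exists c; simpl; auto.
Qed.

(** Any valuation and evaluation point over [A] have a copy over [B], where the formula holds by
    validity; invariance pulls this back. *)
Lemma pure_valid_transfer {A B : Type} (ltA : A -> A -> Prop) (ltB : B -> B -> Prop)
    (t : B) (phi : formula) :
  dense_unbounded_order ltA -> dense_unbounded_order ltB -> pure phi ->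
  valid (order_frame ltB) phi -> valid (order_frame ltA) phi.
Proof.
  intros HA HB Hpure Hval V a.
  destruct (nominals_linked_exists ltA ltB t V (nominals phi) HA HB)
    as (pts & V' & Hiso & Hnom).
  destruct (partial_iso_extend_left ltA ltB pts t a HA HB Hiso) as [b Hb].
  apply (pure_sat_partial_iso ltA ltB V V' phi HA HB Hpure _ a b Hb).
  - now left.
  - exact (nominals_linked_incl V V' _ _ _ _ (incl_refl _)
             (incl_tl _ (incl_refl _)) Hnom).
  - apply Hval.
Qed.

(** * The real line and two copies of it side by side *)

Local Open Scope R_scope.

Lemma Rlt_dense_unbounded_order : dense_unbounded_order Rlt.
Proof.
  split; intros.
  - lra.
  - lra.
  - lra.
  - exists ((x + z) / 2); lra.
  - exists (x - 1); lra.
  - exists (x + 1); lra.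
Qed.

(** Take for [u] the supremum of [X]: every element of [Y] is an upper bound of [X]. *)
Lemma real_cut (X Y : R -> Prop) (x0 y0 : R) :
  X x0 -> Y y0 -> (forall x y, X x -> Y y -> x < y) ->
  exists u, forall x y, X x -> Y y -> x <= u <= y.
Proof.
  intros X0 Y0 H.
  destruct (completeness X) as [u [ub least]].
  - exists y0; intros x Xx; apply Rlt_le; auto.
  - now exists x0.
  - exists u; intros x y Xx Yy; split; [now apply ub |].
    apply least; intros z Xz; apply Rlt_le; auto.
Qed.

Lemma CDLBWE_real_line : CDLBWE (order_frame Rlt).
Proof.
  split; unfold distinct3; simpl.
  - intros x y z H; repeat split; lra.
  - intros; lra.
  - intros; lra.
  - intros; lra.
  - intros; lra.
  - intros x y z (? & ? & ?); lra.
  - intros y; exists (y - 1), (y + 1); lra.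
  - intros x z H; exists ((x + z) / 2); lra.
  - intros X Y [w Hw].
    (* If [X] or [Y] is empty, continuity is vacuous and any point will do. *)
    destruct (classic (exists x, X x)) as [[x0 X0] | nX].
    2:{ exists w; intros x y Xx; destruct nX; now exists x. }
    destruct (classic (exists y, Y y)) as [[y0 Y0] | nY].
    2:{ exists w; intros x y _ Yy; destruct nY; now exists y. }
    assert (H00 := Hw x0 y0 X0 Y0).
    assert (HX := fun x Xx => Hw x y0 Xx Y0).
    assert (HY := fun y Yy => Hw x0 y X0 Yy).
    unfold weak_betw; simpl.
    (* The side of [w] on which [x0] lies fixes the orientation for all of [X] and [Y]; in the
       second case [Y] lies below [X] and the cut is taken with the roles exchanged. *)
    destruct (Rlt_le_dec w x0) as [L | L].
    + destruct (real_cut X Y x0 y0 X0 Y0) as [u Hu].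
      { intros x y Xx Yy.
        specialize (HX x Xx); specialize (HY y Yy); specialize (Hw x y Xx Yy); lra. }
      exists u; intros x y Xx Yy; specialize (Hu x y Xx Yy).
      specialize (Hw x y Xx Yy); lra.
    + destruct (real_cut Y X y0 x0 Y0 X0) as [u Hu].
      { intros y x Yy Xx.
        specialize (HX x Xx); specialize (HY y Yy); specialize (Hw x y Xx Yy); lra. }
      exists u; intros x y Xx Yy; specialize (Hu y x Yy Xx).
      specialize (Hw x y Xx Yy); lra.
Qed.

(** The ordered sum, with the [inl] copy wholly below the [inr] copy and a gap between them. *)
Definition two_lines_lt (x y : R + R) : Prop :=
  match x, y with
  | inl a, inl b | inr a, inr b => a < b
  | inl _, inr _ => True
  | inr _, inl _ => False
  end.

Lemma two_lines_dense_unbounded_order : dense_unbounded_order two_lines_lt.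
Proof.
  split.
  - intros [x | x]; simpl; lra.
  - intros [x | x] [y | y] [z | z]; simpl; lra.
  - intros [x | x] [y | y]; simpl; auto;
      destruct (Rtotal_order x y) as [H | [-> | H]]; auto.
  - intros [x | x] [z | z]; simpl; intros H; try contradiction.
    + exists (inl ((x + z) / 2)); simpl; lra.
    (* Between points of different copies, a step upwards within the first copy suffices. *)
    + exists (inl (x + 1)); simpl; lra.
    + exists (inr ((x + z) / 2)); simpl; lra.
  - intros [x | x]; [exists (inl (x - 1)) | exists (inr (x - 1))]; simpl; lra.
  - intros [x | x]; [exists (inl (x + 1)) | exists (inr (x + 1))]; simpl; lra.
Qed.

(** Continuity fails at the gap: [X] is the positive half of the first copy, [Y] is the second copy,
    and [inl 0] is the witness below both. [X] has no maximum and [Y] no minimum, so even weak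
    betweenness fails. *)
Lemma not_CDLBWE_two_lines : ~ CDLBWE (order_frame two_lines_lt).
Proof.
  intros H.
  destruct (betw_complete _ H
    (fun x : R + R => exists r, 0 < r /\ x = inl r)
    (fun y : R + R => exists r, y = inr r)) as [u Hu].
  - exists (inl 0); intros x y [r [Hr ->]] [s ->]; simpl; auto.
  - unfold weak_betw in Hu; destruct u as [t | t].
    (* The maximum with [0] keeps the point in [X], and adding [1] puts it above [t]. *)
    + destruct (Hu (inl (Rmax t 0 + 1)) (inr 0)) as [B | [B | B]].
      * exists (Rmax t 0 + 1); split; [| reflexivity].
        assert (M := Rmax_r t 0); lra.
      * now exists 0.
      * assert (M := Rmax_l t 0); simpl in B; lra.
      * assert (M := Rmax_l t 0); injection B as B; lra.
      * discriminate B.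
    (* Here [inr (t - 1)] is an element of [Y] below [u]. *)
    + destruct (Hu (inl 1) (inr (t - 1))) as [B | [B | B]].
      * exists 1; split; [lra | reflexivity].
      * now exists (t - 1).
      * simpl in B; lra.
      * discriminate B.
      * injection B as B; lra.
Qed.

Theorem theorem7p12 :
  ~ exists Phi : formula -> Prop,
      (forall phi : formula, Phi phi -> pure phi) /\
      (forall F : frame3,
         CDLBWE F <-> (forall phi : formula, Phi phi -> valid F phi)).
Proof.
  intros [Phi [Hpure Hdef]].
  apply not_CDLBWE_two_lines, Hdef; intros phi Hphi.
  (* Validity passes from the real line to the two copies; [0] is the default point of the line. *)
  apply (pure_valid_transfer two_lines_lt Rlt 0 phi
    two_lines_dense_unbounded_order Rlt_dense_unbounded_order (Hpure phi Hphi)).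
  exact (proj1 (Hdef _) CDLBWE_real_line phi Hphi).
Qed.
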